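(* Let $A$ be an $m\times n$ totally nonnegative real matrix. Then there is a unique pair $\boldsymbol r\subseteq\{1,\dots,m\}$, $\boldsymbol c\subseteq\{1,\dots,n\}$ with $|\boldsymbol r|=|\boldsymbol c|$ such that $A\in\mathcal M_{\boldsymbol r,\boldsymbol c}$. Further, for this pair there is a unique pair of matrices $L\in\mathcal L_{\boldsymbol r}^*$, $U\in\mathcal U_{\boldsymbol c}$ such that $A=LU$. The matrices $L$ and $U$ are totally nonnegative. Writing $\boldsymbol r=\{r_1<\dots<r_t\}$ and $\boldsymbol c=\{c_1<\dots<c_t\}$, they are given explicitly as follows: $L=(l_{ij})$ is the $m\times t$ matrix with $l_{ij}=0$ for $i<r_j$ and $$l_{ij}=[r_1,\dots,r_{j-1},i\,|\,c_1,\dots,c_j]_A\,[r_1,\dots,r_j\,|\,c_1,\dots,c_j]_A^{-1}\quad\text{for } i\ge r_j,$$ and $U=(u_{ij})$ is the $t\times n$ matrix with $u_{ij}=0$ for $j<c_i$ and $$u_{ij}=[r_1,\dots,r_i\,|\,c_1,\dots,c_{i-1},j]_A\,[r_1,\dots,r_{i-1}\,|\,c_1,\dots,c_{i-1}]_A^{-1}\quad\text{for } j\ge c_i.$$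
   Context: All matrices have real entries. A matrix is totally nonnegative if each of its minors (determinants of square submatrices) is nonnegative. For a matrix $A$, a set $I$ of row indices and a set $J$ of column indices with $|I|=|J|$, $[I|J]_A$ denotes the minor $\det A(I,J)$, where $A(I,J)$ is the submatrix with rows $I$ and columns $J$ (indices listed in ascending order); by convention $[\varnothing|\varnothing]_A=1$. For index sets of the same cardinality $I=\{i_1<\dots<i_s\}$ and $I'=\{i_1'<\dots<i_s'\}$, write $I\le I'$ (equivalently $I'\ge I$) if $i_k\le i_k'$ for all $k=1,\dots,s$. Let $\boldsymbol r=\{r_1<\dots<r_t\}\subseteq\{1,\dots,m\}$ and $\boldsymbol c=\{c_1<\dots<c_t\}\subseteq\{1,\dots,n\}$ ($t=0$ is allowed; then the factors are $m\times 0$ and $0\times n$ matrices, whose product is the zero matrix). - $\mathcal L_{\boldsymbol r}$ is the class of $m\times t$ matrices $L=(l_{ij})$ such that for all $j=1,\dots,t$: $l_{r_jj}\ne0$ and $l_{ij}=0$ for all $i<r_j$. $\mathcal L_{\boldsymbol r}^*$ is the subclass of those with also $l_{r_jj}=1$ for all $j$. - $\mathcal U_{\boldsymbol c}$ is the class of $t\times n$ matrices $U=(u_{ij})$ such that for all $i=1,\dots,t$: $u_{ic_i}\ne0$ and $u_{ij}=0$ for all $j<c_i$. - $\mathcal M_{\boldsymbol r,\boldsymbol c}$ is the class of $m\times n$ matrices $A$ such that (1) $\operatorname{rank}(A)=t$; (2) for each $s\le t$, $[r_1,\dots,r_s\,|\,c_1,\dots,c_s]_A\neq0$; (3) $[I|J]_A=0$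 whenever $|I|=|J|=s\le t$ and either $I\not\ge\{r_1,\dots,r_s\}$ or $J\not\ge\{c_1,\dots,c_s\}$. *)

(* Defs.v *)
From HB Require Import structures.
From mathcomp Require Import all_boot all_order all_algebra.

Set Implicit Arguments.
Unset Strict Implicit.
Unset Printing Implicit Defensive.

Import Order.TTheory GRing.Theory Num.Theory.
Local Open Scope ring_scope.

(* Index sets are {set 'I_p}; [enum I] lists I in ascending order. Indices    *)
(* are 0-based: for I = {i_1 < ... < i_t}, [elt e k] is i_(k+1), and          *)
(* [first s I] is {i_1, ..., i_s} (all of I when s >= #|I|).                  *)

Definition elt (p t : nat) (I : {set 'I_p}) (e : #|I| = t) (k : 'I_t) : 'I_p :=
  enum_val (cast_ord (esym e) k).

Definition first (p s : nat) (I : {set 'I_p}) : {set 'I_p} :=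
  [set x in take s (enum I)].

(* [all2] is false on lists of different sizes, so this includes #|I| = #|J|. *)
Definition iset_le (p : nat) (I J : {set 'I_p}) : bool :=
  all2 (fun i j : 'I_p => (i <= j)%N) (enum I) (enum J).

(* [I|J]_A. When #|I| = #|J|, conform_mx only casts the #|I| x #|J| submatrix *)
(* to the square type; minors with #|I| <> #|J| are meaningless.              *)
Definition minor (R : comNzRingType) (m n : nat) (A : 'M[R]_(m, n))
    (I : {set 'I_m}) (J : {set 'I_n}) : R :=
  \det (conform_mx (0 : 'M[R]_#|I|)
          (mxsub (enum_val : 'I_#|I| -> 'I_m) (enum_val : 'I_#|J| -> 'I_n) A)).

Definition totally_nonneg (R : realFieldType) (m n : nat)
    (A : 'M[R]_(m, n)) : Prop :=
  forall (I : {set 'I_m}) (J : {set 'I_n}), #|I| = #|J| -> 0 <= minor A I J.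

Definition in_L (R : fieldType) (m t : nat) (r : {set 'I_m}) (hr : #|r| = t)
    (L : 'M[R]_(m, t)) : Prop :=
  forall j : 'I_t, L (elt hr j) j != 0 /\
    (forall i : 'I_m, (i < elt hr j)%N -> L i j = 0).

Definition in_Lstar (R : fieldType) (m t : nat) (r : {set 'I_m})
    (hr : #|r| = t) (L : 'M[R]_(m, t)) : Prop :=
  in_L hr L /\ (forall j : 'I_t, L (elt hr j) j = 1).

Definition in_U (R : fieldType) (n t : nat) (c : {set 'I_n}) (hc : #|c| = t)
    (U : 'M[R]_(t, n)) : Prop :=
  forall i : 'I_t, U i (elt hc i) != 0 /\
    (forall j : 'I_n, (j < elt hc i)%N -> U i j = 0).

(* Meant for #|r| = #|c|. *)
Definition in_M (R : fieldType) (m n : nat) (r : {set 'I_m}) (c : {set 'I_n})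
    (A : 'M[R]_(m, n)) : Prop :=
  [/\ \rank A = #|r|,
      forall s : nat, (s <= #|r|)%N -> minor A (first s r) (first s c) != 0
    & forall (s : nat) (I : {set 'I_m}) (J : {set 'I_n}),
        #|I| = s -> #|J| = s -> (s <= #|r|)%N ->
        ~~ iset_le (first s r) I \/ ~~ iset_le (first s c) J ->
        minor A I J = 0].

(* Main.v *)
Require Import Defs.
From HB Require Import structures.
From mathcomp Require Import all_boot all_order all_algebra.
From mathcomp Require Import perm zify ring lra.

Set Implicit Arguments.
Unset Strict Implicit.
Unset Printing Implicit Defensive.

Import Order.TTheory GRing.Theory Num.Theory.
Local Open Scope ring_scope.

(** Everything rests on one existence result (tnn_LU): a totally nonnegative A
    is a product L *m U of totally nonnegative echelon factors, L normalised.

    This is obtained by Neville elimination, which clears the first column from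
    the bottom by subtracting from the last row i with A i 0 <> 0 a multiple of
    the row just above it.  If that row starts with 0, total nonnegativity of
    the 2 x 2 minors makes it a zero row, which can be deleted from A and put
    back into L.  Otherwise the subtraction preserves total nonnegativity
    (tnn_neville), and it is undone by a nonnegative bidiagonal factor, whose
    product with L stays totally nonnegative because the two rows involved are
    adjacent: a minor of the product is a minor of L plus a nonnegative multiple
    of either a minor of L or a determinant with a repeated row.  Transposition
    does the same for the first row; what is left is block diagonal, and the
    size drops.  Only elementary row operations occur, so no Cauchy-Binet
    formula is used.

    The heart is tnn_neville.  A minor of the new matrix is, up to a positive
    factor, b_k C_k - b_(k+1) C_(k+1), where b is the first column, zero below
    k+1, and C_x is the minor omitting row x (neville_ineq).  If k is the first
    row this is the expansion along b of the determinant of a totally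
    nonnegative matrix.  The rows above k are removed one at a time by Schur
    complements of the other columns, the column b being merely truncated; that
    the matrix stays totally nonnegative (tnn_schur_col) is the inequality
    det B <= B_00 det B(1|1) for totally nonnegative B, where B(1|1) omits the
    first row and column (det_le_first); it is proved by a Schur complement at
    the opposite corner.

    The rest is triangularity.  If A = L *m U with echelon factors, the columns
    c_1, ..., c_s of U vanish below row s, so A(I, c_1..c_s) is the product of
    the square matrices L(I, 1..s) and an upper triangular one.  This yields the
    nonvanishing minors and the explicit entries of L and U (LU_entries), hence
    uniqueness.  A minor with a row set I not above r vanishes because the rows
    of L it involves include k+1 rows supported on k columns (det_mul_vanish).
    So A lies in the class M of its pivot sets (in_M_LU).  Finally a matrix lies
    in at most one class M (in_M_inj): for two admissible pairs each nonzero
    leading minor of one forces, by the vanishing condition of the other,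
    comparison of the index sets in both directions. *)

(** * Strictly increasing maps and total nonnegativity *)

Definition incr (s m : nat) (f : 'I_s -> 'I_m) : Prop :=
  forall i j : 'I_s, (i < j)%N -> (f i < f j)%N.

(** Row and column sets are given by increasing maps rather than by sets: the
    submatrix is then mxsub, and restricting to a submatrix is composition. *)
Definition tnn (R : realFieldType) (m n : nat) (A : 'M[R]_(m, n)) : Prop :=
  forall (s : nat) (f : 'I_s -> 'I_m) (g : 'I_s -> 'I_n),
    incr f -> incr g -> 0 <= \det (mxsub f g A).

Definition fcons (T : Type) (s : nat) (p : T) (f : 'I_s -> T) : 'I_s.+1 -> T :=
  fun i => oapp f p (unlift ord0 i).

Lemma fcons0 (T : Type) (s : nat) (p : T) (f : 'I_s -> T) : fcons p f ord0 = p.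
Proof. by rewrite /fcons unlift_none. Qed.

Lemma fconsS (T : Type) (s : nat) (p : T) (f : 'I_s -> T) (i : 'I_s) :
  fcons p f (lift ord0 i) = f i.
Proof. by rewrite /fcons liftK. Qed.

Lemma fcons_eta (T : Type) (s : nat) (f : 'I_s.+1 -> T) :
  fcons (f ord0) (f \o lift ord0) =1 f.
Proof. by move=> i; case: (unliftP ord0 i) => [j|] ->; rewrite ?fconsS ?fcons0. Qed.

Lemma incr_inj (s m : nat) (f : 'I_s -> 'I_m) : incr f -> injective f.
Proof.
move=> hf i j fij; apply/val_inj.
by case: (ltngtP i j) => // /hf; rewrite fij ltnn.
Qed.

Lemma incr_ltn (s m : nat) (f : 'I_s -> 'I_m) (i j : 'I_s) :
  incr f -> ((f i < f j) = (i < j))%N.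
Proof.
move=> hf; case: (ltngtP i j) => [/hf //|/hf h|/val_inj ->]; last by rewrite ltnn.
by rewrite ltnNge ltnW.
Qed.

Lemma incr_leq (s m : nat) (f : 'I_s -> 'I_m) (i j : 'I_s) :
  incr f -> ((f i <= f j) = (i <= j))%N.
Proof. by move=> hf; rewrite leqNgt incr_ltn // -leqNgt. Qed.

Lemma incr_comp (s m n : nat) (f : 'I_m -> 'I_n) (g : 'I_s -> 'I_m) :
  incr f -> incr g -> incr (f \o g).
Proof. by move=> hf hg i j ij; apply/hf/hg. Qed.

Lemma incr_lift (s : nat) (k : 'I_s.+1) : incr (lift k).
Proof. by move=> i j; rewrite /= /bump; lia. Qed.

Lemma incr_fcons (s m : nat) (p : 'I_m) (f : 'I_s -> 'I_m) :
  incr f -> (forall i, p < f i)%N -> incr (fcons p f).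
Proof.
move=> hf hp i j; case: (unliftP ord0 j) => [j'|] ->; last by rewrite ltn0.
rewrite fconsS; case: (unliftP ord0 i) => [i'|] ->; rewrite ?fcons0 ?fconsS //.
by rewrite !lift0 ltnS; apply: hf.
Qed.

Lemma incr_gt0 (s m : nat) (f : 'I_s.+1 -> 'I_m) (i : 'I_s) :
  incr f -> (f ord0 < f (lift ord0 i))%N.
Proof. by move=> hf; apply: hf; rewrite lift0. Qed.

Section TotalNonnegativity.

Variable R : realFieldType.

Lemma tnn_sub (m n m' n' : nat) (A : 'M[R]_(m, n)) (f : 'I_m' -> 'I_m)
    (g : 'I_n' -> 'I_n) :
  incr f -> incr g -> tnn A -> tnn (mxsub f g A).
Proof.
by move=> hf hg hA s f' g' hf' hg'; rewrite -mxsub_comp; apply: hA; apply: incr_comp.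
Qed.

Lemma tnn_tr (m n : nat) (A : 'M[R]_(m, n)) : tnn A -> tnn A^T.
Proof. by move=> hA s f g hf hg; rewrite -trmx_mxsub det_tr; apply: hA. Qed.

Lemma tnn_ge0 (m n : nat) (A : 'M[R]_(m, n)) i j : tnn A -> 0 <= A i j.
Proof.
move=> /(_ 1%N (fun=> i) (fun=> j)); rewrite det_mx11 mxE; apply.
  by move=> a b; rewrite !ord1.
by move=> a b; rewrite !ord1.
Qed.

Lemma tnn_minor2 (m n : nat) (A : 'M[R]_(m, n)) (i k : 'I_m) (j l : 'I_n) :
  tnn A -> (i < k)%N -> (j < l)%N -> A i l * A k j <= A i j * A k l.
Proof.
move=> hA ik jl; have inc0 p (h : 'I_0 -> 'I_p) : incr h by case.
have := hA 2%N (fcons i (fun=> k)) (fcons j (fun=> l)).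
rewrite (expand_det_row _ ord0) big_ord_recl big_ord1 /cofactor !det_mx11 !mxE.
have -> : lift ord0 0 = lift ord0 ord0 :> 'I_2 by apply: val_inj.
have -> : lift (lift ord0 ord0) 0 = ord0 :> 'I_2 by apply: val_inj.
rewrite !fconsS !fcons0 /= /bump /= !add0n expr0 expr1 => h.
suff : 0 <= A i j * (1 * A k l) + A i l * (-1 * A k j) by lra.
by apply: h; apply: incr_fcons => // a b; rewrite !ord1.
Qed.

(** If both an entry to the right of a zero and an entry below it were positive,
    the 2 x 2 minor with that zero in its top left corner would be negative. *)
Lemma tnn_corner0 (m n : nat) (A : 'M[R]_(m, n)) (p : 'I_m) (q : 'I_n) :
  tnn A -> A p q = 0 ->
  (forall j : 'I_n, (q < j)%N -> A p j = 0) \/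
  (forall i : 'I_m, (p < i)%N -> A i q = 0).
Proof.
move=> hA Apq.
case: (altP (@forallP _ (fun j : 'I_n => (q < j)%N ==> (A p j == 0)))) => [h|].
  by left=> j qj; have /implyP/(_ qj)/eqP := h j.
rewrite negb_forall => /existsP[j]; rewrite negb_imply => /andP[qj Apj]; right=> i pi.
have := tnn_minor2 hA pi qj; rewrite Apq mul0r => h.
have Apj0 : 0 < A p j by rewrite lt_def Apj tnn_ge0.
by apply/eqP; rewrite eq_le tnn_ge0 // andbT -(pmulr_rle0 _ Apj0).
Qed.

End TotalNonnegativity.

(** * Schur complements *)

Section Determinants.

Variable R : comNzRingType.

Lemma det_row0 s (B : 'M[R]_s) i : (forall j, B i j = 0) -> \det B = 0.
Proof. by move=> h; rewrite (expand_det_row _ i) big1 // => j _; rewrite h mul0r. Qed.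

Lemma det_col0 s (B : 'M[R]_s) j : (forall i, B i j = 0) -> \det B = 0.
Proof. by move=> h; rewrite (expand_det_col _ j) big1 // => i _; rewrite h mul0r. Qed.

(** Reversing rows and columns multiplies by the same sign twice. *)
Lemma det_rev s (B : 'M[R]_s) : \det (mxsub (@rev_ord s) (@rev_ord s) B) = \det B.
Proof.
pose p := perm (@rev_ord_inj s).
have -> : mxsub (@rev_ord s) (@rev_ord s) B = row_perm p (col_perm p B).
  by apply/matrixP=> i j; rewrite !mxE !permE.
rewrite row_permE col_permE !det_mulmx !det_perm odd_permV mulrCA mulrA.
by rewrite -mulrA -signr_addb addbb mulr1.
Qed.

End Determinants.

Section Schur.

Variable F : fieldType.

(** The matrix keeps its size, with row p and column q cleared when the pivot
    is nonzero, so that minors of the Schur complement use the index maps of the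
    original matrix. *)
Definition schur (m n : nat) (p : 'I_m) (q : 'I_n) (A : 'M[F]_(m, n)) :=
  \matrix_(i < m, j < n) (A i j - A i q / A p q * A p j).

(** Block elimination.  No order on the indices is assumed, so the pivot may lie
    anywhere relative to the other rows and columns. *)
Lemma schurE (m n : nat) (p : 'I_m) (q : 'I_n) (A : 'M[F]_(m, n)) s
    (f : 'I_s -> 'I_m) (g : 'I_s -> 'I_n) : A p q != 0 ->
  \det (mxsub (fcons p f) (fcons q g) A) = A p q * \det (mxsub f g (schur p q A)).
Proof.
move=> d0; set d := A p q; pose S := mxsub f g (schur p q A).
pose u : 'rV_s := \row_j A p (g j); pose v : 'cV_s := \col_i (A (f i) q / d).
have -> : mxsub (fcons p f) (fcons q g) A =
   (block_mx 1%:M 0 v 1%:M *m block_mx d%:M u 0 S : 'M_(1 + s)).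
  rewrite mulmx_block !mul1mx !mul0mx !addr0.
  apply/matrixP=> i j; rewrite mxE.
  case: (unliftP ord0 i) => [i'|] ->; case: (unliftP ord0 j) => [j'|] ->;
    rewrite ?fconsS ?fcons0.
  - have -> : lift ord0 i' = rshift 1 i' by apply: val_inj.
    have -> : lift ord0 j' = rshift 1 j' by apply: val_inj.
    apply: (etrans _ (esym (block_mxEdr _ _ _ _ i' j'))).
    by rewrite !mxE big_ord1 !mxE; ring.
  - have -> : lift ord0 i' = rshift 1 i' by apply: val_inj.
    have -> : ord0 = lshift s (ord0 : 'I_1) by apply: val_inj.
    apply: (etrans _ (esym (block_mxEdl _ _ _ _ i' ord0))).
    by rewrite !mxE big_ord1 !mxE eqxx mulr1n divfK.
  - have -> : lift ord0 j' = rshift 1 j' by apply: val_inj.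
    have -> : ord0 = lshift s (ord0 : 'I_1) by apply: val_inj.
    apply: (etrans _ (esym (block_mxEur _ _ _ _ ord0 j'))).
    by rewrite !mxE.
  - have -> : ord0 = lshift s (ord0 : 'I_1) by apply: val_inj.
    apply: (etrans _ (esym (block_mxEul _ _ _ _ ord0 ord0))).
    by rewrite !mxE eqxx.
rewrite det_mulmx (det_lblock (1%:M : 'M_1)) (det_ublock (d%:M : 'M_1)).
by rewrite !det1 !mul1r det_scalar1.
Qed.

Lemma schur_det (s : nat) (B : 'M[F]_s.+1) : B ord0 ord0 != 0 ->
  \det B = B ord0 ord0 * \det (mxsub (lift ord0) (lift ord0) (schur ord0 ord0 B)).
Proof.
move=> d0; rewrite -schurE //; congr (\det _); apply/matrixP=> i j; rewrite mxE.
by rewrite !(fcons_eta id).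
Qed.

End Schur.

Section TotalNonnegativitySchur.

Variable R : realFieldType.

Lemma tnn_schur (m n : nat) (p : 'I_m) (q : 'I_n) (A : 'M[R]_(m, n)) s
    (f : 'I_s -> 'I_m) (g : 'I_s -> 'I_n) :
  tnn A -> A p q != 0 -> incr f -> incr g ->
  (forall i, p < f i)%N -> (forall j, q < g j)%N ->
  0 <= \det (mxsub f g (schur p q A)).
Proof.
move=> hA d0 hf hg hp hq.
have d_gt0 : 0 < A p q by rewrite lt_def d0 tnn_ge0.
rewrite -(pmulr_rge0 _ d_gt0) -schurE //.
by apply: hA; apply: incr_fcons.
Qed.

Lemma tnn_schur0 (m n : nat) (A : 'M[R]_(m.+1, n.+1)) :
  tnn A -> A ord0 ord0 != 0 -> tnn (mxsub (lift ord0) (lift ord0) (schur ord0 ord0 A)).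
Proof.
move=> hA d0 s f g hf hg; rewrite -mxsub_comp; apply: tnn_schur => //;
  by apply: incr_comp => //; apply: incr_lift.
Qed.

Lemma tnn_det s (B : 'M[R]_s) : tnn B -> 0 <= \det B.
Proof. by move=> /(_ s id id); rewrite mxsub_id; apply. Qed.

(** * Determinantal inequalities *)

(** Pivot at the opposite corner (0,0): both determinants are the pivot times the
    corresponding determinant of the Schur complement S, which is smaller and
    totally nonnegative, and S's last entry is at most that of B.  A zero pivot
    gives B a zero row or column. *)
Lemma det_le_last s (B : 'M[R]_s.+1) : tnn B ->
  \det B <= B ord_max ord_max * \det (mxsub (lift ord_max) (lift ord_max) B).
Proof.
elim: s B => [|s IH] B hB.
  by rewrite det_mx11 det_mx00 mulr1; rewrite (_ : ord_max = 0) //; apply: val_inj.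
have hM : tnn (mxsub (lift ord_max) (lift ord_max) B).
  by apply: tnn_sub => //; apply: incr_lift.
case: (eqVneq (B ord0 ord0) 0) => [d0|d0].
  suff -> : \det B = 0 by rewrite mulr_ge0 ?tnn_ge0 ?tnn_det.
  case: (tnn_corner0 hB d0) => h.
    by apply: (det_row0 (i := ord0)) => j; case: (posnP j) => [/(@val_inj _ _ _ j ord0)->|/h].
  by apply: (det_col0 (j := ord0)) => j; case: (posnP j) => [/(@val_inj _ _ _ j ord0)->|/h].
set S := mxsub (lift ord0) (lift ord0) (schur ord0 ord0 B).
have hS : tnn S by apply: tnn_schur0.
have d_gt0 : 0 < B ord0 ord0 by rewrite lt_def d0 tnn_ge0.
have lift00 : lift ord_max ord0 = ord0 :> 'I_s.+2 by apply: val_inj.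
have liftm : lift ord0 ord_max = ord_max :> 'I_s.+2 by apply: val_inj.
have liftC i : lift ord_max (lift ord0 i) = lift ord0 (lift ord_max i) :> 'I_s.+2.
  by apply: val_inj; rewrite /= /bump; case: i => i /=; lia.
have detM : \det (mxsub (lift ord_max) (lift ord_max) B) =
    B ord0 ord0 * \det (mxsub (lift ord_max) (lift ord_max) S).
  rewrite schur_det mxE lift00 //; congr (_ * \det _).
  by apply/matrixP=> i j; rewrite !mxE !lift00 !liftC.
rewrite schur_det // detM mulrCA ler_pM2l //.
apply: le_trans (IH S hS) _; apply: ler_wpM2r.
  by apply: tnn_det; apply: tnn_sub => //; apply: incr_lift.
rewrite !mxE liftm gerBl mulr_ge0 ?divr_ge0 ?tnn_ge0 //.
Qed.

Lemma tnn_rev (m n : nat) (A : 'M[R]_(m, n)) :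
  tnn A -> tnn (mxsub (@rev_ord m) (@rev_ord n) A).
Proof.
move=> hA s f g hf hg; rewrite -mxsub_comp -det_rev -mxsub_comp.
have h p (k : 'I_s -> 'I_p) : incr k -> incr ((@rev_ord p \o k) \o @rev_ord s).
  move=> hk i j ij /=; have : (k (rev_ord j) < k (rev_ord i))%N.
    by apply: hk => /=; have := ltn_ord j; lia.
  by have := ltn_ord (k (rev_ord i)); lia.
by apply: hA; apply: h.
Qed.

(** Reversing all indices preserves total nonnegativity and exchanges the two
    corners. *)
Lemma det_le_first s (B : 'M[R]_s.+1) : tnn B ->
  \det B <= B ord0 ord0 * \det (mxsub (lift ord0) (lift ord0) B).
Proof.
move=> /tnn_rev/det_le_last; rewrite det_rev mxE.
have -> : rev_ord ord_max = ord0 :> 'I_s.+1 by apply: val_inj; rewrite /=; lia.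
move/le_trans; apply; rewrite -(det_rev (mxsub (lift ord0) _ _)) -!mxsub_comp.
have e : @rev_ord s.+1 \o lift ord_max =1 lift ord0 \o @rev_ord s.
  move=> i; apply: val_inj; rewrite /= /bump.
  by have : (i < s)%N := ltn_ord i; move: (nat_of_ord i) => k; lia.
by rewrite (eq_mxsub _ _ e e).
Qed.

(** Pivoting at (0,1) after replacing the entry (0,0) by 0 leaves the first
    column untouched and reduces the other columns.  Up to the pivot, and the
    sign of the exchange of the first two columns, the resulting determinant is
    that of the truncated matrix, i.e. \det Z minus its (0,0) term, which is
    nonpositive by det_le_first. *)
Lemma tnn_trunc_schur s (Z : 'M[R]_s.+2) :
  tnn Z -> Z ord0 (lift ord0 ord0) != 0 ->
  0 <= \det (\matrix_(i < s.+1, j < s.+1)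
     if j == ord0 then Z (lift ord0 i) ord0 else 
        schur ord0 (lift ord0 ord0) Z (lift ord0 i) (lift ord0 j)).
Proof.
set o1 := lift ord0 ord0 => hZ d0; set W := \matrix_(_, _) _.
have d_gt0 : 0 < Z ord0 o1 by rewrite lt_def d0 tnn_ge0.
(* Z with its corner entry cleared, which removes the corner term of the Laplace
   expansion along row 0 *)
pose Z0 := \matrix_(i, j) (if (i == ord0) && (j == ord0) then 0 else Z i j).
have detZ0 : \det Z0 = \det Z - Z ord0 ord0 * \det (mxsub (lift ord0) (lift ord0) Z).
  rewrite [\det Z](expand_det_row _ ord0) [\det Z0](expand_det_row _ ord0).
  rewrite big_ord_recl [X in _ = X - _]big_ord_recl mxE /= mul0r add0r.
  have -> : cofactor Z ord0 ord0 = \det (mxsub (lift ord0) (lift ord0) Z).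
    rewrite /cofactor addn0 expr0 mul1r; congr (\det _).
    by apply/matrixP=> a b; rewrite !mxE.
  rewrite [RHS]addrC addKr; apply: eq_bigr => j _.
  rewrite !mxE /=; congr (_ * (_ * \det _)).
  by apply/matrixP=> a b; rewrite !mxE.
have detZ0_le0 : \det Z0 <= 0 by rewrite detZ0 subr_le0 det_le_first.
(* listing column 1 first and then the others is exchanging columns 0 and 1 *)
have detP : \det (mxsub (fcons ord0 (lift ord0)) (fcons o1 (lift o1)) Z0) = - \det Z0.
  have -> : mxsub (fcons ord0 (lift ord0)) (fcons o1 (lift o1)) Z0 = xcol ord0 o1 Z0.
    apply/matrixP=> i j; rewrite !mxE (fcons_eta id).
    suff -> : fcons o1 (lift o1) j = tperm ord0 o1 j by [].
    case: (unliftP ord0 j) => [k|] ->; rewrite ?fconsS ?fcons0 ?tpermL //.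
    case: (unliftP ord0 k) => [l|] ->.
      rewrite tpermD //; first by apply: val_inj.
    by rewrite tpermR; apply: val_inj.
  by rewrite xcolE det_mulmx det_perm odd_tperm mulrN1.
have Zo1 : Z0 ord0 o1 = Z ord0 o1 by rewrite mxE.
have := schurE (A := Z0) (lift ord0) (lift o1) (p := ord0) (q := o1).
rewrite detP Zo1 => /(_ d0) e.
rewrite -(pmulr_rge0 _ d_gt0).
suff -> : W = mxsub (lift ord0) (lift o1) (schur ord0 o1 Z0).
  by rewrite -e oppr_ge0.
apply/matrixP=> i j; rewrite !mxE /=.
case: (unliftP ord0 j) => [k|] -> /=.
  have -> : lift o1 (lift ord0 k) = lift ord0 (lift ord0 k) by apply: val_inj.
  by [].
have -> : lift o1 ord0 = ord0 :> 'I_s.+2 by apply: val_inj.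
by rewrite /= mulr0 subr0.
Qed.

End TotalNonnegativitySchur.

Section NevilleInequality.

Variable R : realFieldType.

Lemma incr_rshift1 (s n : nat) (f : 'I_s -> 'I_n) :
  incr f -> incr (@rshift 1 n \o f).
Proof. by move=> hf i j ij /=; rewrite ltn_add2l hf. Qed.

Lemma incr_gt_ord0 (s m : nat) (f : 'I_s -> 'I_m.+1) : incr f ->
  (forall i, f i != ord0) -> exists2 f' : 'I_s -> 'I_m, incr f' & f =1 lift ord0 \o f'.
Proof.
move=> hf h0.
have /fin_all_exists [f' hf'] : forall i, exists j, f i = lift ord0 j.
  move=> i; case: (unliftP ord0 (f i)) => [j ->|/eqP]; first by exists j.
  by rewrite (negPf (h0 i)).
exists f' => // i j ij.
by have := hf i j ij; rewrite !hf' !lift0 ltnS.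
Qed.

Lemma incr_pos (s m : nat) (f : 'I_s.+1 -> 'I_m.+1) : incr f ->
  f ord0 != ord0 -> forall i, f i != ord0.
Proof.
move=> hf h0 i; case: (unliftP ord0 i) => [j|] -> //.
by rewrite -lt0n; apply: leq_ltn_trans (incr_gt0 j hf).
Qed.

Lemma tnn_row_mxr (m n : nat) (b : 'cV[R]_m) (M : 'M[R]_(m, n)) :
  tnn (row_mx b M) -> tnn M.
Proof.
have -> : tnn M = tnn (mxsub id (@rshift 1 n \o id) (row_mx b M)).
  by congr tnn; apply/matrixP=> i j; rewrite mxE row_mxEr.
by apply: tnn_sub => //; apply: incr_rshift1.
Qed.

Lemma row_mx0 (m n : nat) (b : 'cV[R]_m) (M : 'M[R]_(m, n)) i :
  row_mx b M i (ord0 : 'I_n.+1) = b i ord0.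
Proof. by rewrite -[RHS](row_mxEl b M); congr (row_mx _ _ _ _); apply: val_inj. Qed.

(** This is what allows induction in neville_ineq: M is reduced at its corner
    while the column b merely loses its first entry. *)
Lemma tnn_schur_col (s n : nat) (b : 'cV[R]_s.+1) (M : 'M[R]_(s.+1, n.+1)) :
  tnn (row_mx b M) -> M ord0 ord0 != 0 ->
  tnn (row_mx (rowsub (lift ord0) b)
              (mxsub (lift ord0) (lift ord0) (schur ord0 ord0 M))).
Proof.
move=> hbM d0; set S := mxsub (lift ord0) (lift ord0) (schur _ _ _).
have hM := tnn_row_mxr hbM.
have hS : tnn S := tnn_schur0 hM d0.
move=> [|l] f g hf hg; first by rewrite det_mx00.
case: (eqVneq (g ord0) ord0) => [g0|g0]; last first.
  have [g' hg' eg] := incr_gt_ord0 hg (incr_pos hg g0).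
  have -> : mxsub f g (row_mx (rowsub (lift ord0) b) S) = mxsub f g' S.
    apply/matrixP=> i j; rewrite [LHS]mxE [RHS]mxE eg /=.
    have -> : lift ord0 (g' j) = rshift 1 (g' j) by apply: val_inj.
    by rewrite row_mxEr.
  exact: hS.
have [g' hg' eg] : exists2 g' : 'I_l -> 'I_n, incr g' & g \o lift ord0 =1 lift ord0 \o g'.
  apply: incr_gt_ord0 => [i j ij|i] /=; first by apply: hg; rewrite !lift0.
  by rewrite -lt0n; apply: leq_ltn_trans (incr_gt0 i hg).
(* a minor through the truncated column: restore row 0 and the pivot column to
   get a submatrix of [b | M] with the pivot at position (0,1) *)
pose Z := mxsub (fcons ord0 (lift ord0 \o f))
  (fcons (lshift n.+1 (ord0 : 'I_1))
    (@rshift 1 n.+1 \o fcons ord0 (lift ord0 \o g'))) (row_mx b M).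
have hZ : tnn Z.
  apply: tnn_sub hbM.
    by apply: incr_fcons => //; apply: incr_comp => //; apply: incr_lift.
  apply: incr_fcons => //; apply: incr_rshift1; apply: incr_fcons => //.
have Z1 : Z ord0 (lift ord0 ord0) = M ord0 ord0.
  by rewrite mxE fcons0 fconsS /= fcons0 row_mxEr.
have := tnn_trunc_schur hZ; rewrite Z1 => /(_ d0).
congr (0 <= \det _); apply/matrixP=> i j; rewrite [LHS]mxE [RHS]mxE.
case: (unliftP ord0 j) => [k|] -> /=.
  have -> : g (lift ord0 k) = rshift 1 (g' k).
    by rewrite -[LHS]/((g \o _) _) eg; apply: val_inj.
  rewrite row_mxEr mxE Z1 /Z mxE fconsS fconsS /= fconsS row_mxEr.
  rewrite [mxsub _ _ _ _ (lift ord0 ord0)]mxE fconsS fconsS /= fcons0 row_mxEr.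
  rewrite [mxsub _ _ _ ord0 _]mxE fcons0 fconsS /= fconsS row_mxEr.
  by rewrite /S !mxE.
have -> : g ord0 = lshift n (ord0 : 'I_1) by rewrite g0; apply: val_inj.
by rewrite row_mxEl /Z !mxE fcons0 fconsS (unsplitK (inl _)).
Qed.

Lemma det_rowsub_corner0 s (B : 'M[R]_(s.+2, s.+1)) (k : 'I_s.+1) :
  (forall j, B ord0 j = 0) \/ (forall i, B i ord0 = 0) ->
  \det (rowsub (lift (lift ord0 k)) B) = 0.
Proof.
case=> h.
  apply: (det_row0 (i := ord0)) => j; rewrite mxE.
  by have -> : lift (lift ord0 k) ord0 = ord0 by apply: val_inj.
by apply: (det_col0 (j := ord0)) => i; rewrite mxE.
Qed.

(** When k is the first row, the difference of the two sides is the Laplace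
    expansion of \det (row_mx b M) along b.  Otherwise the pivot M 0 0 divides
    out of both sides and lowers k by one. *)
Lemma neville_ineq s (b : 'cV[R]_s.+1) (M : 'M[R]_(s.+1, s)) (k : 'I_s) :
  tnn (row_mx b M) ->
  (forall x : 'I_s.+1, (k.+1 < x)%N -> b x ord0 = 0) ->
  b (lift ord0 k) ord0 * \det (rowsub (lift (lift ord0 k)) M) <=
  b (widen_ord (leqnSn s) k) ord0 * \det (rowsub (lift (widen_ord (leqnSn s) k)) M).
Proof.
elim: s b M k => [|s IH] b M k hbM hb; first by case: k hb.
case: (unliftP ord0 k) hb => [k'|] -> hb; last first.
  have -> : widen_ord (leqnSn s.+1) ord0 = ord0 by apply: val_inj.
  have := tnn_det (hbM : @tnn R (s.+2) (s.+2) _).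
  rewrite (expand_det_col _ (ord0 : 'I_s.+2)) 2!big_ord_recl big1 => [|i _]; last first.
    by rewrite row_mx0 hb ?mul0r // !lift0.
  rewrite !row_mx0 addr0 /cofactor /= /bump /= !addn0 expr0 expr1.
  have cof i : row' i (col' (ord0 : 'I_s.+2) (row_mx b M)) = rowsub (lift i) M.
    apply/matrixP=> x y; rewrite !mxE.
    have -> : lift (ord0 : 'I_s.+2) y = rshift 1 y by apply: val_inj.
    by rewrite (unsplitK (inr _)).
  by rewrite !cof mul1r mulN1r mulrN subr_ge0.
have wk : widen_ord (leqnSn s.+1) (lift ord0 k') = lift ord0 (widen_ord (leqnSn s) k').
  by apply: val_inj.
rewrite wk.
have hM := tnn_row_mxr hbM.
case: (eqVneq (M ord0 ord0) 0) => [d0|d0].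
  have h0 : (forall j, M ord0 j = 0) \/ (forall i, M i ord0 = 0).
    case: (tnn_corner0 hM d0) => h; [left => j|right => i].
      by case: (unliftP ord0 j) => [j'|] -> //; apply: h.
    by case: (unliftP ord0 i) => [i'|] -> //; apply: h.
  by rewrite !det_rowsub_corner0 // !mulr0.
have d_gt0 : 0 < M ord0 ord0 by rewrite lt_def d0 tnn_ge0.
set S := mxsub (lift ord0) (lift ord0) (schur ord0 ord0 M).
have detM x : \det (rowsub (lift (lift ord0 x)) M) =
    M ord0 ord0 * \det (rowsub (lift x) S).
  have l0 : lift (lift ord0 x) ord0 = ord0 by apply: val_inj.
  rewrite schur_det mxE l0 //; congr (_ * \det _).
  apply/matrixP=> i j; rewrite !mxE !l0.
  have -> // : lift (lift ord0 x) (lift ord0 i) = lift ord0 (lift x i).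
  by apply: val_inj; rewrite /= /bump; lia.
rewrite !detM mulrCA [leRHS]mulrCA ler_pM2l //.
have := IH _ _ k' (tnn_schur_col hbM d0).
rewrite !mxE; apply => x kx; rewrite mxE hb //.
Qed.

End NevilleInequality.

(** * Neville elimination *)

Section RowOperations.

Variable R : comNzRingType.

Definition addrow (m n : nat) (i0 i1 : 'I_m) (q : R) (A : 'M[R]_(m, n)) :=
  \matrix_(i < m, j < n) (if i == i1 then A i j + q * A i0 j else A i j).

Definition upd (s m : nat) (f : 'I_s -> 'I_m) (a : 'I_s) (x : 'I_m) : 'I_s -> 'I_m :=
  fun k => if k == a then x else f k.

Lemma addrow_mul (m n p : nat) (i0 i1 : 'I_m) q (A : 'M[R]_(m, n)) (B : 'M_(n, p)) :
  addrow i0 i1 q A *m B = addrow i0 i1 q (A *m B).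
Proof.
apply/matrixP=> i j; rewrite !mxE; case: ifP => ii1.
  by rewrite mulr_sumr -big_split /=; apply: eq_bigr => k _; rewrite !mxE ii1 mulrDl mulrA.
by apply: eq_bigr => k _; rewrite mxE ii1.
Qed.

Lemma addrowK (m n : nat) (i0 i1 : 'I_m) q (A : 'M[R]_(m, n)) : i0 != i1 ->
  addrow i0 i1 q (addrow i0 i1 (- q) A) = A.
Proof.
move=> h; apply/matrixP=> i j; rewrite !mxE (negPf h); case: (i == i1) => //.
by rewrite mulNr subrK.
Qed.

Lemma mxsub_addrow_notin (m n : nat) (i0 i1 : 'I_m) q (A : 'M[R]_(m, n)) s
    (f : 'I_s -> 'I_m) (g : 'I_s -> 'I_n) : (forall i, f i != i1) ->
  mxsub f g (addrow i0 i1 q A) = mxsub f g A.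
Proof. by move=> h; apply/matrixP=> i j; rewrite !mxE (negPf (h i)). Qed.

Lemma det_addrow (m n : nat) (i0 i1 : 'I_m) q (A : 'M[R]_(m, n)) s
    (f : 'I_s -> 'I_m) (g : 'I_s -> 'I_n) a : incr f -> f a = i1 ->
  \det (mxsub f g (addrow i0 i1 q A)) =
  \det (mxsub f g A) + q * \det (mxsub (upd f a i0) g A).
Proof.
move=> hf fa; rewrite -[\det (mxsub f g A)]mul1r; apply: (determinant_multilinear (i0 := a)).
- by apply/matrixP=> i j; rewrite !mxE fa eqxx /upd eqxx mul1r.
- apply/matrixP=> i j; rewrite !mxE -fa (inj_eq (incr_inj hf)).
  by rewrite eq_sym (negPf (neq_lift _ _)).
- apply/matrixP=> i j; rewrite !mxE -fa (inj_eq (incr_inj hf)) /upd.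
  by rewrite eq_sym (negPf (neq_lift _ _)).
Qed.

Lemma det_upd_dup (m n : nat) (A : 'M[R]_(m, n)) s
    (f : 'I_s -> 'I_m) (g : 'I_s -> 'I_n) a a' : a' != a ->
  \det (mxsub (upd f a (f a')) g A) = 0.
Proof.
move=> aa'; apply: (determinant_alternate aa') => j.
by rewrite !mxE /upd eqxx (negPf aa').
Qed.

End RowOperations.

(** Moving one index down by one step keeps the map increasing as long as the
    new value is not taken; this is why only adjacent rows are combined. *)
Lemma incr_upd (s m : nat) (f : 'I_s -> 'I_m) a (i0 : 'I_m) : incr f ->
  f a = i0.+1 :> nat -> (forall k, f k != i0) -> incr (upd f a i0).
Proof.
move=> hf fa h i j ij; rewrite /upd.
have hi := h i; rewrite -val_eqE /= in hi.
have fij := hf _ _ ij.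
case: eqP => [ea|na]; case: eqP => [eb|nb] //.
- by move: ij; rewrite ea eb ltnn.
- by move: fij; rewrite ea; lia.
- by move: fij; rewrite eb; lia.
Qed.

Section NevilleStep.

Variable R : realFieldType.

(** A minor that meets row i1 gains q times the determinant with row i0 in its
    place, which is a minor if i0 is new and 0 if it is repeated. *)
Lemma tnn_addrow (m n : nat) (i0 i1 : 'I_m) q (A : 'M[R]_(m, n)) :
  i1 = i0.+1 :> nat -> 0 <= q -> tnn A -> tnn (addrow i0 i1 q A).
Proof.
move=> ei q0 hA s f g hf hg.
case: (pickP (fun a => f a == i1)) => [a /eqP fa|h]; last first.
  by rewrite mxsub_addrow_notin ?hA // => i; rewrite h.
rewrite (det_addrow _ _ _ _ hf fa) addr_ge0 ?hA // mulr_ge0 //.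
case: (pickP (fun a => f a == i0)) => [a' /eqP fa'|h].
  rewrite -fa' det_upd_dup //; apply: contra_eq_neq fa => <-.
  by rewrite fa' -val_eqE /= ei; lia.
apply: hA => //; apply: incr_upd => //; first by rewrite fa.
by move=> k; rewrite h.
Qed.

(** Whitney's reduction theorem.  Only minors with row i1 but not i0 matter;
    inserting i0 next to i1 in their row set gives the (s+1) x s matrix to which
    neville_ineq applies. *)
Lemma tnn_neville (m n : nat) (A : 'M[R]_(m, n.+1)) (i0 i1 : 'I_m) :
  tnn A -> i1 = i0.+1 :> nat -> A i0 ord0 != 0 ->
  (forall x : 'I_m, (i1 < x)%N -> A x ord0 = 0) ->
  tnn (addrow i0 i1 (- (A i1 ord0 / A i0 ord0)) A).
Proof.
move=> hA ei A0 hx s f g hf hg.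
have A0_gt0 : 0 < A i0 ord0 by rewrite lt_def A0 tnn_ge0.
case: (pickP (fun a => f a == i1)) => [a /eqP fa|h]; last first.
  by rewrite mxsub_addrow_notin ?hA // => i; rewrite h.
rewrite (det_addrow _ _ _ _ hf fa).
case: (pickP (fun a => f a == i0)) => [a' /eqP fa'|h].
  rewrite -fa' det_upd_dup ?mulr0 ?addr0 ?hA //; apply: contra_eq_neq fa => <-.
  by rewrite fa' -val_eqE /= ei; lia.
(* h_ lists the rows of f with i0 inserted at position a, just before i1 *)
pose k0 := widen_ord (leqnSn s) a.
have ek : k0 = a :> nat by [].
pose h_ (x : 'I_s.+1) : 'I_m := oapp f i0 (unlift k0 x).
have h_k0 : h_ k0 = i0 by rewrite /h_ unlift_none.
have h_l x : h_ (lift k0 x) = f x by rewrite /h_ liftK.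
have hfi x : (f x < i0)%N = (x < a)%N.
  rewrite -(incr_ltn _ _ hf) fa; have := h x; rewrite -val_eqE /=; lia.
have hh : incr h_.
  move=> x y; case: (unliftP k0 x) => [x'|] ->; case: (unliftP k0 y) => [y'|] ->;
    rewrite ?h_l ?h_k0 /= /bump.
  - by rewrite incr_ltn //; do 2![case: leqP => /=]; lia.
  - by rewrite (hfi x'); case: leqP => /=; lia.
  - by have := hfi y'; have := h y'; rewrite -val_eqE /=; lia.
  - by rewrite ltnn.
have h_up : h_ \o lift (lift ord0 a) =1 upd f a i0.
  move=> y; rewrite /upd /=; case: eqP => [->|/eqP ya].
    by rewrite -h_k0; congr h_; apply: val_inj; rewrite /= /bump; lia.
  rewrite -h_l; congr h_; apply: val_inj; move: ya; rewrite -val_eqE /= /bump; lia.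
pose B := row_mx (\col_i A (h_ i) ord0) (mxsub h_ g A).
(* column 0 may occur twice in B, once in front and once through g; minors
   containing both copies vanish *)
have hB : tnn B.
  move=> l f' g' hf' hg'.
  pose gg (j : 'I_(1 + s)) : 'I_n.+1 := match split j with inl _ => ord0 | inr j => g j end.
  have -> : mxsub f' g' B = mxsub (h_ \o f') (gg \o g') A.
    by apply/matrixP=> i j; rewrite !mxE /gg /=; case: splitP => x; rewrite !mxE.
  have [e|ne] := boolP (injectiveb (gg \o g')).
    apply: hA; first exact: incr_comp.
    move=> i j ij; have := hg' i j ij; rewrite /comp.
    have : gg (g' i) != gg (g' j).
      by apply/eqP => /(injectiveP _ e) eij; rewrite eij ltnn in ij.
    rewrite /gg; case: splitP => x ex; case: splitP => y ey ne' le.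
    - by rewrite eqxx in ne'.
    - by move: ne'; rewrite eq_sym -val_eqE /= -lt0n.
    - by move: le; rewrite ex ey; have := ltn_ord y; lia.
    - by apply: hg; move: le; rewrite ex ey ltn_add2l.
  have /injectivePn[x [y xy exy]] := ne.
  rewrite -det_tr; suff -> : \det (mxsub (h_ \o f') (gg \o g') A)^T = 0 by [].
  by apply: (determinant_alternate xy) => j; rewrite !mxE; move: exy => /= ->.
have := neville_ineq (k := a) hB; rewrite -/k0.
have Bk : (\col_i A (h_ i) ord0) (lift ord0 a) ord0 = A i1 ord0.
  rewrite mxE -fa -h_l; congr (A (h_ _) _).
  by apply: val_inj; rewrite /= /bump; lia.
have e2 : rowsub (lift (lift ord0 a)) (mxsub h_ g A) = mxsub (upd f a i0) g A.
  by apply/matrixP=> i j; rewrite !mxE -h_up.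
have e1 : rowsub (lift k0) (mxsub h_ g A) = mxsub f g A.
  by apply/matrixP=> i j; rewrite !mxE h_l.
rewrite Bk mxE h_k0 e1 e2 => ineq.
have {}ineq : A i1 ord0 * \det (mxsub (upd f a i0) g A) <= A i0 ord0 * \det (mxsub f g A).
  apply: ineq => x ax; rewrite mxE hx //.
  rewrite -fa -h_l incr_ltn // /= /bump; lia.
rewrite -(pmulr_rge0 _ A0_gt0) mulrDr mulrA mulrN mulrCA divff // mulr1 mulNr subr_ge0.
exact: ineq.
Qed.

End NevilleStep.

(** * Existence of totally nonnegative echelon factors *)

Definition echelon (F : fieldType) (m t : nat) (r : 'I_t -> 'I_m)
    (L : 'M[F]_(m, t)) : Prop :=
  forall j, L (r j) j != 0 /\ (forall i : 'I_m, (i < r j)%N -> L i j = 0).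

Section Existence.

Variable R : realFieldType.

Definition echelon_factorable (m n : nat) (A : 'M[R]_(m, n)) : Prop :=
  exists t (r : 'I_t -> 'I_m) (c : 'I_t -> 'I_n) (L : 'M[R]_(m, t)) (V : 'M[R]_(n, t)),
    [/\ incr r /\ incr c, echelon r L /\ echelon c V, tnn L /\ tnn V & A = L *m V^T].

Lemma echelon_factorable0 (m n : nat) : echelon_factorable (0 : 'M[R]_(m, n)).
Proof.
have r p : 'I_0 -> 'I_p by case.
have tnn0 p : tnn (0 : 'M[R]_(p, 0)).
  by move=> [|s] f g _ _; [rewrite det_mx00 | case: (g ord0)].
exists 0%N, (r m), (r n), 0, 0; split; [by split; case | by split; case | split; exact: tnn0 |].
by rewrite mul0mx.
Qed.

(** Asking L only to have nonzero, not unit, pivots makes the two factors play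
    symmetric roles; the normalisation is postponed to tnn_LU. *)
Lemma echelon_factorable_tr (m n : nat) (A : 'M[R]_(m, n)) :
  echelon_factorable A^T -> echelon_factorable A.
Proof.
move=> [t [c [r [V [L [[hc hr] [eV eL] [tV tL] eA]]]]]]; exists t, r, c, L, V; split=> //.
by rewrite -[A]trmxK eA trmx_mul trmxK.
Qed.

Definition insrow (m n : nat) (i0 : 'I_m) (B : 'M[R]_(m.-1, n)) : 'M[R]_(m, n) :=
  \matrix_(i < m, j < n) (if unlift i0 i is Some k then B k j else 0).

Lemma tnn_insrow (m n : nat) (i0 : 'I_m.+1) (B : 'M[R]_(m, n)) :
  tnn B -> tnn (insrow i0 B).
Proof.
move=> hB s f g hf hg.
case: (pickP (fun a => f a == i0)) => [a /eqP fa|h].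
  by rewrite (det_row0 (i := a)) // => j; rewrite !mxE fa unlift_none.
have /fin_all_exists [f' hf'] : forall a, exists k, f a = lift i0 k.
  move=> a; case: (unliftP i0 (f a)) => [k ->|/eqP]; first by exists k.
  by rewrite h.
have -> : mxsub f g (insrow i0 B) = mxsub f' g B.
  by apply/matrixP=> a b; rewrite !mxE hf' liftK.
apply: hB => // a b ab; rewrite -(incr_ltn _ _ (@incr_lift _ i0)) -!hf'; exact: hf.
Qed.

Lemma echelon_factorable_row0 (m n : nat) (A : 'M[R]_(m.+1, n)) (i0 : 'I_m.+1) :
  (forall j, A i0 j = 0) -> echelon_factorable (row' i0 A) -> echelon_factorable A.
Proof.
move=> h0 [t [r [c [L [V [[hr hc] [eL eV] [tL tV] eA]]]]]].
exists t, (lift i0 \o r), c, (insrow i0 L), V; split=> //.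
- by split=> //; apply: incr_comp => //; apply: incr_lift.
- split=> // j; have [nz z] := eL j; rewrite /= mxE liftK; split=> // i.
  rewrite mxE; case: unliftP => // k ->.
  by rewrite (incr_ltn _ _ (@incr_lift _ i0)); apply: z.
- by split=> //; apply: tnn_insrow.
- apply/matrixP=> i j; rewrite mxE.
  case: (unliftP i0 i) => [k|] ->.
    have := congr1 (fun M : 'M_(_, _) => M k j) eA; rewrite /= !mxE => ->.
    by apply: eq_bigr => l _; rewrite !mxE liftK.
  by rewrite h0 big1 // => l _; rewrite mxE unlift_none mul0r.
Qed.

Lemma echelon_factorable_addrow (m n : nat) (A : 'M[R]_(m, n)) (i0 i1 : 'I_m) q :
  i1 = i0.+1 :> nat -> 0 <= q -> echelon_factorable A -> echelon_factorable (addrow i0 i1 q A).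
Proof.
move=> ei q0 [t [r [c [L [V [hrc [eL eV] [tL tV] ->]]]]]].
exists t, r, c, (addrow i0 i1 q L), V; split=> //; last by rewrite addrow_mul.
- split=> // j; have [nz z] := eL j; rewrite !mxE.
  split=> [|i hi]; last first.
    rewrite mxE; case: eqP => [ei1|_]; rewrite !z ?mulr0 ?addr0 //.
    by move: hi; rewrite ei1 ei; lia.
  by case: (eqVneq (r j) i1) => [e|//]; rewrite (z i0) ?mulr0 ?addr0 // e ei.
- by split=> //; apply: tnn_addrow.
Qed.

Definition dsum (m n : nat) (a : R) (B : 'M[R]_(m, n)) : 'M[R]_(m.+1, n.+1) :=
  \matrix_(i, j) match unlift ord0 i, unlift ord0 j with
                 | Some i', Some j' => B i' j'
                 | None, None => a
                 | _, _ => 0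
                 end.

Lemma tnn_dsum (m n : nat) (a : R) (B : 'M[R]_(m, n)) :
  0 < a -> tnn B -> tnn (dsum a B).
Proof.
move=> a0 hB [|s] f g hf hg; first by rewrite det_mx00.
case: (eqVneq (f ord0) ord0) => f0; case: (eqVneq (g ord0) ord0) => g0.
- have pos p (h : 'I_s.+1 -> 'I_p.+1) : incr h -> h ord0 = ord0 ->
      exists2 h' : 'I_s -> 'I_p, incr h' & h =1 fcons ord0 (lift ord0 \o h').
    move=> hh h0; have [|i|h' hh' eh] := @incr_gt_ord0 _ _ (h \o lift ord0).
    + by apply: incr_comp => //; apply: incr_lift.
    + by rewrite -lt0n; apply: leq_ltn_trans (incr_gt0 i hh).
    exists h' => // i; rewrite -(fcons_eta h) h0.
    by case: (unliftP ord0 i) => [j|] ->; rewrite ?fconsS ?fcons0.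
  have [f' hf' ef] := pos _ _ hf f0; have [g' hg' eg] := pos _ _ hg g0.
  have d0 : dsum a B ord0 ord0 = a by rewrite mxE !unlift_none.
  rewrite (eq_mxsub _ _ ef eg) schurE d0 ?gt_eqF // pmulr_rge0 //.
  have -> : mxsub (lift ord0 \o f') (lift ord0 \o g') (schur ord0 ord0 (dsum a B))
            = mxsub f' g' B.
    by apply/matrixP=> i j; rewrite !mxE /= !liftK !unlift_none mulr0 subr0.
  exact: hB.
- rewrite (det_row0 (i := ord0)) // => j; rewrite !mxE f0 unlift_none.
  by case: unliftP => // ej; have := incr_pos hg g0 j; rewrite ej eqxx.
- rewrite (det_col0 (j := ord0)) // => i; rewrite !mxE g0 unlift_none.
  by case: unliftP => // ei; have := incr_pos hf f0 i; rewrite ei eqxx.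
- have [f' hf' ef] := incr_gt_ord0 hf (incr_pos hf f0).
  have [g' hg' eg] := incr_gt_ord0 hg (incr_pos hg g0).
  have -> : mxsub f g (dsum a B) = mxsub f' g' B.
    by apply/matrixP=> i j; rewrite !mxE ef eg /= !liftK.
  exact: hB.
Qed.

Lemma echelon_dsum (m t : nat) (a : R) (r : 'I_t -> 'I_m) (L : 'M[R]_(m, t)) :
  a != 0 -> echelon r L -> echelon (fcons ord0 (lift ord0 \o r)) (dsum a L).
Proof.
move=> a0 eL j; case: (unliftP ord0 j) => [k|] ->; rewrite ?fconsS ?fcons0 mxE /=.
  have [nz z] := eL k; rewrite !liftK; split=> // i; rewrite mxE liftK.
  by case: unliftP => // i' ->; rewrite !lift0 ltnS => /z.
by rewrite !unlift_none; split.
Qed.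

Lemma incr_fcons0 (s m : nat) (f : 'I_s -> 'I_m) :
  incr f -> incr (fcons ord0 (lift ord0 \o f)).
Proof. by move=> hf; apply: incr_fcons => //; apply: incr_comp => //; apply: incr_lift. Qed.

Lemma echelon_factorable_dsum (m n : nat) (a : R) (S : 'M[R]_(m, n)) :
  0 < a -> echelon_factorable S -> echelon_factorable (dsum a S).
Proof.
move=> a0 [t [r [c [L [V [[hr hc] [eL eV] [tL tV] ->]]]]]].
exists t.+1, (fcons ord0 (lift ord0 \o r)), (fcons ord0 (lift ord0 \o c)),
  (dsum 1 L), (dsum a V); split.
- by split; apply: incr_fcons0.
- by split; apply: echelon_dsum; rewrite ?oner_eq0 ?gt_eqF.
- by split; apply: tnn_dsum.
apply/matrixP=> i j; rewrite !mxE big_ord_recl !mxE unlift_none.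
have -> : \sum_(k < t) dsum 1 L i (lift ord0 k) * (dsum a V)^T (lift ord0 k) j =
  if (unlift ord0 i, unlift ord0 j) is (Some i', Some j') then (L *m V^T) i' j' else 0.
  case: (unliftP ord0 i) => [i'|] ->; last first.
    by rewrite big1 // => k _; rewrite !mxE liftK unlift_none mul0r.
  case: (unliftP ord0 j) => [j'|] ->; last first.
    by rewrite big1 // => k _; rewrite !mxE !liftK unlift_none mulr0.
  by rewrite mxE; apply: eq_bigr => k _; rewrite !mxE !liftK.
by case: unliftP => [i'|] _; case: unliftP => [j'|] _;
  rewrite ?mul0r ?mulr0 ?mul1r ?add0r ?addr0.
Qed.

(** Termination measure: a Neville step removes one nonzero entry of the first
    column and does not touch the first row. *)
Definition weight (m n : nat) (A : 'M[R]_(m.+1, n.+1)) : nat :=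
  (#|[set i | A i ord0 != 0%R]| + #|[set j | A ord0 j != 0%R]|)%N.

Lemma weight_tr (m n : nat) (A : 'M[R]_(m.+1, n.+1)) : weight A^T = weight A.
Proof. by rewrite /weight addnC; congr (_ + _)%N; apply: eq_card => i; rewrite !inE mxE. Qed.

(** The last nonzero entry of the first column has a nonzero entry just above
    it: otherwise tnn_corner0 would make the row above zero. *)
Lemma neville_step (m n : nat) (A : 'M[R]_(m.+1, n.+1)) (i : 'I_m.+1) :
  tnn A -> (forall i, ~ (forall j, A i j = 0)) -> i != ord0 -> A i ord0 != 0 ->
  exists (A' : 'M[R]_(m.+1, n.+1)) (i0 i1 : 'I_m.+1) (q : R),
    [/\ i1 = i0.+1 :> nat, 0 <= q, tnn A', (weight A' < weight A)%N
      & A = addrow i0 i1 q A'].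
Proof.
move=> hA nz i_n0 Ai.
case: (@arg_maxnP _ i (fun i : 'I_m.+1 => A i ord0 != 0) (@nat_of_ord m.+1) Ai) => i1 Ai1 maxi.
have i1_gt0 : (0 < i1)%N by apply: leq_trans (maxi _ Ai); rewrite lt0n.
have hi0 : (i1.-1 < m.+1)%N by have := ltn_ord i1; lia.
pose i0 := Ordinal hi0.
have ei : i1 = i0.+1 :> nat by rewrite /= prednK.
have Ai0 : A i0 ord0 != 0.
  apply/eqP => A0; case: (tnn_corner0 hA A0) => h.
    apply: (nz i0) => j; case: (unliftP ord0 j) => [k|] -> //.
    by apply: h; rewrite lift0.
  by move: Ai1; rewrite h ?eqxx // ei.
have i01 : i0 != i1 by rewrite -val_eqE /=; lia.
exists (addrow i0 i1 (- (A i1 ord0 / A i0 ord0)) A), i0, i1, (A i1 ord0 / A i0 ord0).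
split=> //.
- by rewrite divr_ge0 ?tnn_ge0.
- apply: tnn_neville => // x hx; apply/eqP; apply: contraTT hx => /maxi.
  by rewrite -leqNgt.
- rewrite /weight -addSn; apply: leq_add.
    apply: proper_card; apply/properP; split.
      apply/subsetP => x; rewrite !inE mxE; case: (eqVneq x i1) => [->|//].
      by rewrite mulNr divfK // subrr eqxx.
    exists i1; rewrite !inE // mxE eqxx mulNr divfK // subrr eqxx //.
  apply: eq_leq; apply: eq_card => j; rewrite !inE mxE.
  by rewrite ifN // eq_sym -val_eqE /= -lt0n.
- by rewrite addrowK.
Qed.

(** Outer induction on the size, inner induction on the weight. *)
Lemma tnn_echelon_factorable (m n : nat) (A : 'M[R]_(m, n)) :
  tnn A -> echelon_factorable A.
Proof.
have [N] := ubnP (m + n); elim: N m n A => // N IHN [|m] n A hN hA.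
  by rewrite (flatmx0 A); apply: echelon_factorable0.
case: n A hN hA => [|n] A hN hA; first by rewrite (thinmx0 A); apply: echelon_factorable0.
have [k] := ubnP (weight A); elim: k A hA => // k IHk A hA hk.
have zrow p q (B : 'M[R]_(p.+1, q.+1)) : (p + q.+1 < N)%N -> tnn B ->
    echelon_factorable B \/ forall i, ~ (forall j, B i j = 0).
  move=> hpq hB; have [/existsP[i /forallP h]|] := boolP [exists i, [forall j, B i j == 0]].
    left; apply: (@echelon_factorable_row0 _ _ _ i) => [j|]; first exact/eqP.
    by apply: IHN => //; rewrite row'Esub; apply: tnn_sub => //; apply: incr_lift.
  rewrite negb_exists => /forallP h; right=> i hi; have /negP := h i; apply.
  by apply/forallP => j; rewrite hi.
have [//|nzr] := zrow _ _ A ltac:(lia) hA.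
have [/echelon_factorable_tr//|nzc] := zrow _ _ A^T ltac:(lia) (tnn_tr hA).
case: (pickP (fun i => (i != ord0) && (A i ord0 != 0))) => [i /andP[i0 Ai]|hcol].
  have [A' [i0' [i1 [q [ei q0 tA' wA' ->]]]]] := neville_step hA nzr i0 Ai.
  by apply: echelon_factorable_addrow => //; apply: IHk => //; apply: leq_trans wA' _.
case: (pickP (fun j => (j != ord0) && (A ord0 j != 0))) => [j /andP[j0 Aj]|hrow].
  have Aj' : A^T j ord0 != 0 by rewrite mxE.
  have [A' [i0' [i1 [q [ei q0 tA' wA' eA]]]]] := neville_step (tnn_tr hA) nzc j0 Aj'.
  apply: echelon_factorable_tr; rewrite eA; apply: echelon_factorable_addrow => //.
  apply: echelon_factorable_tr; apply: IHk; first exact: tnn_tr.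
  by rewrite weight_tr; apply: leq_trans wA' _; rewrite weight_tr.
have eA : A = dsum (A ord0 ord0) (mxsub (lift ord0) (lift ord0) A).
  apply/matrixP=> i j; rewrite !mxE.
  case: (unliftP ord0 i) => [i'|] ->; case: (unliftP ord0 j) => [j'|] -> //; rewrite ?mxE //.
    by have /negbFE/eqP := hcol (lift ord0 i').
  by have /negbFE/eqP := hrow (lift ord0 j').
have A0 : 0 < A ord0 ord0.
  rewrite lt_def tnn_ge0 // andbT; apply/eqP => A0; apply: (nzr ord0) => j.
  by rewrite eA mxE unlift_none A0; case: unlift.
rewrite eA; apply: echelon_factorable_dsum => //; apply: IHN; first by lia.
by apply: tnn_sub => //; apply: incr_lift.
Qed.

Lemma tnn_scalecol (m n : nat) (A : 'M[R]_(m, n)) (d : 'rV[R]_n) :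
  (forall j, 0 <= d ord0 j) -> tnn A -> tnn (A *m diag_mx d).
Proof.
move=> d0 hA s f g hf hg.
have -> : mxsub f g (A *m diag_mx d) = mxsub f g A *m diag_mx (colsub g d).
  by apply/matrixP=> i j; rewrite !mul_mx_diag !mxE.
rewrite det_mulmx det_diag mulr_ge0 ?hA // prodr_ge0 // => i _.
by rewrite mxE.
Qed.

(** The pivots of L are moved into U; they are positive, being nonzero entries
    of a totally nonnegative matrix. *)
Lemma tnn_LU (m n : nat) (A : 'M[R]_(m, n)) : tnn A ->
  exists t (r : 'I_t -> 'I_m) (c : 'I_t -> 'I_n) (L : 'M[R]_(m, t)) (U : 'M[R]_(t, n)),
    [/\ incr r /\ incr c, echelon r L /\ (forall j, L (r j) j = 1), echelon c U^T,
        tnn L /\ tnn U & A = L *m U].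
Proof.
move=> /tnn_echelon_factorable [t [r [c [L [V [hrc [eL eV] [tL tV] ->]]]]]].
pose d : 'rV_t := \row_j L (r j) j; pose e : 'rV_t := \row_j (L (r j) j)^-1.
have d0 j : d ord0 j != 0 by rewrite mxE; case: (eL j).
have ed : diag_mx e *m diag_mx d = 1%:M.
  rewrite mulmx_diag -diag_const_mx; congr diag_mx; apply/rowP => j.
  by have := d0 j; rewrite !mxE => h; rewrite mulVf.
have dge j : 0 <= d ord0 j by rewrite mxE tnn_ge0.
exists t, r, c, (L *m diag_mx e), (V *m diag_mx d)^T; split=> //.
- split=> j.
    have [nz z] := eL j; rewrite mul_mx_diag mxE !mxE mulf_neq0 ?invr_eq0 //; split=> // i hi.
    by rewrite mxE z ?mul0r.
  by rewrite mul_mx_diag !mxE divff //; case: (eL j).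
- move=> j; rewrite trmxK mul_mx_diag mxE.
  have [nz z] := eV j; split=> [|i hi]; first by rewrite mulf_neq0.
  by rewrite mxE z ?mul0r.
- split; last by apply: tnn_tr; apply: tnn_scalecol.
  by apply: tnn_scalecol => // j; rewrite mxE invr_ge0 tnn_ge0.
- by rewrite trmx_mul tr_diag_mx -mulmxA (mulmxA (diag_mx e)) ed mul1mx.
Qed.

End Existence.

(** * Index sets and increasing maps *)

Lemma sorted_enum_set (p : nat) (I : {set 'I_p}) :
  sorted (fun i j : 'I_p => (i < j)%N) (enum I).
Proof.
rewrite /enum_mem -enumT; apply: sorted_filter; first by move=> j i k; apply: ltn_trans.
by have := iota_ltn_sorted 0 p; rewrite -val_enum_ord sorted_map.
Qed.

Lemma enum_imset_incr (s p : nat) (f : 'I_s -> 'I_p) :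
  incr f -> enum (f @: setT) = map f (enum 'I_s).
Proof.
move=> hf; apply: (@irr_sorted_eq _ (fun i j : 'I_p => (i < j)%N)).
- by move=> j i k; apply: ltn_trans.
- by move=> i; rewrite ltnn.
- exact: sorted_enum_set.
- rewrite sorted_map; have := sorted_enum_set (setT : {set 'I_s}).
  rewrite enum_setT -enumT; apply: sub_sorted; exact: hf.
- move=> x; rewrite mem_enum; apply/imsetP/mapP => [[k _ ->]|[k _ ->]]; exists k => //.
  by rewrite mem_enum.
Qed.

Lemma card_imset_incr (s p : nat) (f : 'I_s -> 'I_p) : incr f -> #|f @: setT| = s.
Proof. by move=> hf; rewrite card_imset ?cardsT ?card_ord //; apply: incr_inj. Qed.

Lemma elt_incr (p t : nat) (I : {set 'I_p}) (e : #|I| = t) : incr (elt e).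
Proof.
have sz : size (enum I) = t by rewrite -cardE.
move=> i j ij; rewrite /elt !(enum_val_nth (elt e i)).
apply: (@sorted_ltn_nth _ (fun i j : 'I_p => (i < j)%N)) => //.
- by move=> k l n; apply: ltn_trans.
- exact: sorted_enum_set.
- by rewrite inE sz /=.
- by rewrite inE sz /=.
Qed.

Lemma elt_imset (p t : nat) (I : {set 'I_p}) (e : #|I| = t) : elt e @: setT = I.
Proof.
apply/eqP; rewrite eqEcard card_imset_incr ?e ?leqnn ?andbT; last exact: elt_incr.
by apply/subsetP => _ /imsetP[k _ ->]; apply: enum_valP.
Qed.

(** Together with elt_imset, this makes index sets of size s and increasing maps
    from 'I_s interchangeable. *)
Lemma elt_imset_incr (s p : nat) (f : 'I_s -> 'I_p) (e : #|f @: setT| = s) :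
  incr f -> elt e =1 f.
Proof.
move=> hf k; rewrite /elt (enum_val_nth (f k)) enum_imset_incr //.
by rewrite (nth_map k) ?size_enum_ord //=; congr f; apply: val_inj; rewrite /= nth_enum_ord.
Qed.

Lemma widen_incr (s t : nat) (h : (s <= t)%N) : incr (widen_ord h).
Proof. by move=> i j. Qed.

Lemma first_imset (s t p : nat) (h : (s <= t)%N) (f : 'I_t -> 'I_p) :
  incr f -> first s (f @: setT) = (f \o widen_ord h) @: setT.
Proof.
move=> hf; apply/setP=> x; rewrite inE -[RHS]mem_enum (enum_imset_incr hf).
rewrite (enum_imset_incr (incr_comp hf (widen_incr h))) -map_take map_comp.
suff -> : take s (enum 'I_t) = map (widen_ord h) (enum 'I_s) by [].
apply: (inj_map val_inj); rewrite map_take val_enum_ord take_iota (minn_idPl h).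
by rewrite -map_comp -[LHS]val_enum_ord; apply: eq_map.
Qed.

Lemma iset_leE (s p : nat) (f g : 'I_s -> 'I_p) : incr f -> incr g ->
  iset_le (f @: setT) (g @: setT) = [forall k, (f k <= g k)%N].
Proof.
move=> hf hg; rewrite /iset_le !enum_imset_incr //.
transitivity (all (fun k => f k <= g k)%N (enum 'I_s)).
  by elim: (enum _) => //= k l ->.
apply/allP/forallP => h k; first by apply: h; rewrite mem_enum.
by move=> _; apply: h.
Qed.

Lemma minor_elt (R : comNzRingType) (m n s : nat) (A : 'M[R]_(m, n)) (I : {set 'I_m})
    (J : {set 'I_n}) (eI : #|I| = s) (eJ : #|J| = s) :
  minor A I J = \det (mxsub (elt eI) (elt eJ) A).
Proof.
case: s / eI eJ => eJ; rewrite /minor.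
have -> : mxsub (enum_val : 'I_#|I| -> 'I_m) (enum_val : 'I_#|J| -> 'I_n) A =
    castmx (erefl, esym eJ) (mxsub (elt erefl) (elt eJ) A).
  apply/matrixP=> i j; rewrite castmxE !mxE /= /elt.
  have -> : cast_ord (esym erefl) (cast_ord erefl i) = i by apply: val_inj.
  by have -> : cast_ord (esym eJ) (cast_ord (esym (esym eJ)) j) = j by apply: val_inj.
by rewrite conform_castmx conform_mx_id.
Qed.

Lemma minor_imset (R : comNzRingType) (m n s : nat) (A : 'M[R]_(m, n))
    (f : 'I_s -> 'I_m) (g : 'I_s -> 'I_n) : incr f -> incr g ->
  minor A (f @: setT) (g @: setT) = \det (mxsub f g A).
Proof.
move=> hf hg; rewrite (minor_elt A (card_imset_incr hf) (card_imset_incr hg)).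
by congr (\det _); apply: eq_mxsub; apply: elt_imset_incr.
Qed.

Lemma totally_nonnegP (R : realFieldType) (m n : nat) (A : 'M[R]_(m, n)) :
  totally_nonneg A <-> tnn A.
Proof.
split=> [hA s f g hf hg|hA I J e].
  by rewrite -minor_imset //; apply: hA; rewrite !card_imset_incr.
by rewrite (minor_elt A e erefl); apply: hA; apply: elt_incr.
Qed.

(** * Minors of a product of echelon matrices *)

Section Echelon.

Variable F : fieldType.

(** The rows f 0, ..., f k of L lie above r k, so they are supported on the
    first k columns and k.+1 of them are dependent; a dependency among them
    annihilates the corresponding rows of the product. *)
Lemma det_mul_vanish (m n t s : nat) (L : 'M[F]_(m, t)) (U : 'M[F]_(t, n))
    (r : 'I_t -> 'I_m) (f : 'I_s -> 'I_m) (g : 'I_s -> 'I_n) (k : 'I_s) (k' : 'I_t) :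
  incr r -> echelon r L -> incr f -> k = k' :> nat -> (f k < r k')%N ->
  \det (mxsub f g (L *m U)) = 0.
Proof.
move=> hr eL hf ek fk.
have hks : (k.+1 <= s)%N by [].
have hkt : (k <= t)%N by rewrite ek ltnW.
(* W is (k+1) x k, so it has a nonzero left kernel vector *)
pose h := widen_ord hks; pose w := widen_ord hkt.
pose W := mxsub (f \o h) w L : 'M_(k.+1, k).
have : kermx W != 0.
  rewrite kermx_eq0 -row_leq_rank -ltnNge ltnS; exact: rank_leq_col.
case/rowV0Pn => v /sub_kermxP vW v0.
apply/eqP/det0P; exists (v *m rowsub h 1%:M).
  apply: contra_neq v0 => e; apply/rowP => i.
  have := congr1 (fun X : 'M_(_, _) => X ord0 (h i)) e.
  rewrite !mxE (bigD1 i) //= big1 => [|j ji]; first by rewrite !mxE eqxx mulr1 addr0.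
  by rewrite !mxE -val_eqE /= (val_eqE j i) (negPf ji) mulr0.
rewrite -mulmxA -rowsubE mxsub_mul -mul_rowsub_mx mulmxA.
suff -> : v *m rowsub h (rowsub f L) = 0 by rewrite mul0mx.
apply/rowP => j; rewrite !mxE; have [jk|kj] := ltnP j k.
  have := congr1 (fun X : 'M_(_, _) => X ord0 (Ordinal jk)) vW; rewrite !mxE => e.
  rewrite -[RHS]e; apply: eq_bigr => i _; rewrite !mxE; congr (_ * L _ _).
  exact: val_inj.
rewrite big1 // => i _; rewrite !mxE; have [_ ->] := eL j; rewrite ?mulr0 //.
apply: (@leq_ltn_trans (f k)); first by rewrite incr_leq //= -ltnS.
by apply: leq_trans fk _; rewrite incr_leq // -ek.
Qed.

Lemma mulmx_narrow (m n s t : nat) (h : (s <= t)%N) (X : 'M[F]_(m, t)) (Y : 'M[F]_(t, n)) :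
  (forall (i : 'I_t) j, (s <= i)%N -> Y i j = 0) ->
  X *m Y = colsub (widen_ord h) X *m rowsub (widen_ord h) Y.
Proof.
move=> h0; apply/matrixP=> i j; rewrite !mxE.
rewrite (bigID (fun k : 'I_t => (k < s)%N)) /= addrC big1 ?add0r => [|k]; last first.
  by rewrite -leqNgt => /h0 ->; rewrite mulr0.
by rewrite (big_ord_narrow h); apply: eq_bigr => k _; rewrite !mxE.
Qed.

Lemma det_echelon (n t s : nat) (h : (s <= t)%N) (c : 'I_t -> 'I_n) (V : 'M[F]_(n, t)) :
  incr c -> echelon c V ->
  \det (mxsub (c \o widen_ord h) (widen_ord h) V) =
  \prod_(k < s) V (c (widen_ord h k)) (widen_ord h k).
Proof.
move=> hc eV; rewrite det_trig; first by apply: eq_bigr => k _; rewrite mxE.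
by apply/is_trig_mxP => i j ij; rewrite mxE; have [_ ->] := eV (widen_ord h j); rewrite ?hc.
Qed.

(** The last row of the submatrix is arbitrary: being last, it does not disturb
    triangularity, and it contributes its diagonal entry only. *)
Lemma det_echelon_last (m t s : nat) (h : (s < t)%N) (r : 'I_t -> 'I_m)
    (L : 'M[F]_(m, t)) (f : 'I_s.+1 -> 'I_m) :
  incr r -> echelon r L ->
  (forall k : 'I_s, f (widen_ord (leqnSn s) k) = r (widen_ord (ltnW h) k)) ->
  \det (mxsub f (widen_ord h) L) =
  (\prod_(k < s) L (r (widen_ord (ltnW h) k)) (widen_ord (ltnW h) k))
    * L (f ord_max) (Ordinal h).
Proof.
move=> hr eL hf; rewrite det_trig.
  rewrite big_ord_recr /=; congr (_ * _); last first.
    by rewrite mxE; congr (L _ _); apply: val_inj.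
  by apply: eq_bigr => k _; rewrite mxE hf; congr (L _ _); apply: val_inj.
apply/is_trig_mxP => i j ij; rewrite mxE.
have i_s : (i < s)%N by apply: leq_trans ij _; rewrite -ltnS.
have -> : i = widen_ord (leqnSn s) (Ordinal i_s) by apply: val_inj.
by rewrite hf; have [_ ->] := eL (widen_ord h j); rewrite ?hr.
Qed.

(** The pivot columns c 0, ..., c (s-1) of V^T vanish from row s on, so the
    minor is a product of two square determinants, the second triangular. *)
Lemma det_mul_echelon (m n t s : nat) (h : (s <= t)%N) (c : 'I_t -> 'I_n)
    (L : 'M[F]_(m, t)) (V : 'M[F]_(n, t)) (f : 'I_s -> 'I_m) :
  incr c -> echelon c V ->
  \det (mxsub f (c \o widen_ord h) (L *m V^T)) =
  \det (mxsub f (widen_ord h) L) * \prod_(k < s) V (c (widen_ord h k)) (widen_ord h k).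
Proof.
move=> hc eV; rewrite mxsub_mul (mulmx_narrow h) => [|i j si]; last first.
  rewrite !mxE; have [_ ->] := eV i; rewrite //= incr_ltn //.
  exact: leq_trans (ltn_ord j) si.
rewrite det_mulmx -!mxsubcr -mxsubrc; congr (_ * _).
by rewrite -det_tr trmx_mxsub trmxK det_echelon.
Qed.

Lemma minor_first_echelon (m n t s : nat) (h : (s <= t)%N) (r : 'I_t -> 'I_m)
    (c : 'I_t -> 'I_n) (L : 'M[F]_(m, t)) (V : 'M[F]_(n, t)) :
  incr r -> incr c -> echelon r L -> echelon c V ->
  minor (L *m V^T) (first s (r @: setT)) (first s (c @: setT)) =
  (\prod_(k < s) L (r (widen_ord h k)) (widen_ord h k)) *
  (\prod_(k < s) V (c (widen_ord h k)) (widen_ord h k)).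
Proof.
move=> hr hc eL eV; rewrite !(first_imset h) // minor_imset; last first.
- by apply: incr_comp => //; apply: widen_incr.
- by apply: incr_comp => //; apply: widen_incr.
by rewrite det_mul_echelon // det_echelon.
Qed.

Lemma prod_echelon_neq0 (m t s : nat) (h : (s <= t)%N) (r : 'I_t -> 'I_m)
    (L : 'M[F]_(m, t)) : echelon r L ->
  \prod_(k < s) L (r (widen_ord h k)) (widen_ord h k) != 0.
Proof. by move=> eL; apply/prodf_neq0 => k _; case: (eL (widen_ord h k)). Qed.

Lemma in_M_LU (m n t : nat) (r : 'I_t -> 'I_m) (c : 'I_t -> 'I_n)
    (L : 'M[F]_(m, t)) (V : 'M[F]_(n, t)) :
  incr r -> incr c -> echelon r L -> echelon c V ->
  in_M (r @: setT) (c @: setT) (L *m V^T).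
Proof.
move=> hr hc eL eV; have cr := card_imset_incr hr.
split; rewrite ?cr.
- apply/eqP; rewrite eqn_leq; apply/andP; split.
    by apply: leq_trans (mulmx_max_rank L V^T) _.
  have d0 : \det (mxsub r c (L *m V^T)) != 0.
    have := minor_first_echelon (leqnn t) hr hc eL eV.
    rewrite !(first_imset (leqnn t)) // minor_imset; try exact: incr_comp (widen_incr _).
    move=> e.
    have -> : mxsub r c (L *m V^T) =
        mxsub (r \o widen_ord (leqnn t)) (c \o widen_ord (leqnn t)) (L *m V^T).
      by apply: eq_mxsub => k; congr (_ _); apply: val_inj.
    by rewrite e mulf_neq0 // prod_echelon_neq0.
  have /mxrank_unit rk : mxsub r c (L *m V^T) \in unitmx by rewrite unitmxE unitfE.
  rewrite -[X in (X <= _)%N]rk mxsubcr -[rowsub r _]mulmx1 -mulmx_colsub.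
  apply: leq_trans (mxrankM_maxl _ _) _; rewrite rowsubE; exact: mxrankM_maxr.
- by move=> s hs; rewrite (minor_first_echelon hs) // mulf_neq0 // prod_echelon_neq0.
- move=> s I J eI eJ hs; rewrite !(first_imset hs) // -{1}(elt_imset eI) -{1}(elt_imset eJ).
  have wr p (q : 'I_t -> 'I_p) : incr q -> incr (q \o widen_ord hs).
    by move=> hq; apply: incr_comp => //; apply: widen_incr.
  rewrite !iset_leE; try (exact: elt_incr); try (exact: wr).
  rewrite (minor_elt _ eI eJ) !negb_forall.
  case=> /existsP[k]; rewrite -ltnNge /= => hk.
    by apply: (det_mul_vanish _ _ hr eL _ (k := k) (k' := widen_ord hs k)) => //; apply: elt_incr.
  rewrite -det_tr trmx_mxsub trmx_mul trmxK.
  by apply: (det_mul_vanish _ _ hc eV _ (k := k) (k' := widen_ord hs k)) => //; apply: elt_incr.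
Qed.

Lemma iset_le_anti (p : nat) (I J : {set 'I_p}) :
  #|I| = #|J| -> iset_le I J -> iset_le J I -> I = J.
Proof.
move eJ : #|J| => t eI; rewrite -(elt_imset eI) -(elt_imset eJ).
rewrite !iset_leE; try exact: elt_incr.
move=> /forallP h1 /forallP h2; apply: eq_imset => k.
by apply: val_inj; apply/eqP; rewrite eqn_leq h1 h2.
Qed.

Lemma first_all (p : nat) (I : {set 'I_p}) : first #|I| I = I.
Proof. by apply/setP => x; rewrite inE cardE take_size mem_enum. Qed.

(** The full pivot minor of the first pair is nonzero, so the vanishing condition
    of the second pair cannot apply to it. *)
Lemma in_M_le (m n : nat) (A : 'M[F]_(m, n)) (r r' : {set 'I_m}) (c c' : {set 'I_n}) :
  #|r| = #|c| -> #|r'| = #|c'| -> in_M r c A -> in_M r' c' A ->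
  iset_le r' r /\ iset_le c' c.
Proof.
move=> e e' [rk nz _] [rk' _ z].
have err : #|r'| = #|r| by rewrite -rk rk'.
have ecc : #|r| = #|c'| by rewrite -err.
have := nz #|r| (leqnn _); rewrite first_all e first_all.
case h : (iset_le r' r && iset_le c' c); first by move: h => /andP.
rewrite (z #|r| r c) ?err ?eqxx // -{1}err first_all ecc first_all.
by move/negbT: h; rewrite negb_and => /orP.
Qed.

Lemma in_M_inj (m n : nat) (A : 'M[F]_(m, n)) (r r' : {set 'I_m}) (c c' : {set 'I_n}) :
  #|r| = #|c| -> #|r'| = #|c'| -> in_M r c A -> in_M r' c' A -> r = r' /\ c = c'.
Proof.
move=> e e' hA hA'; have [h1 h2] := in_M_le e e' hA hA'.
have [h3 h4] := in_M_le e' e hA' hA.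
have err : #|r| = #|r'| by case: hA => <- _ _; case: hA'.
by split; apply: iset_le_anti; rewrite -?e -?e'.
Qed.

(** Since i is at least the pivot r_s, it comes after the first s pivots, so
    listing those and then i is increasing. *)
Lemma setU1_imset (t s p : nat) (h : (s < t)%N) (r : 'I_t -> 'I_p) (i : 'I_p) :
  incr r -> (r (Ordinal h) <= i)%N ->
  exists2 f : 'I_s.+1 -> 'I_p, incr f &
    [/\ i |: first s (r @: setT) = f @: setT, f ord_max = i &
        forall k : 'I_s, f (widen_ord (leqnSn s) k) = r (widen_ord (ltnW h) k)].
Proof.
move=> hr hi.
pose f (k : 'I_s.+1) := if (k < s)%N then r (widen_ord h k) else i.
have fw (k : 'I_s) : f (widen_ord (leqnSn s) k) = r (widen_ord (ltnW h) k).
  by rewrite /f /= ltn_ord; congr r; apply: val_inj.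
have fm : f ord_max = i by rewrite /f /= ltnn.
exists f; last split=> //.
  move=> k l kl; rewrite /f.
  have ks : (k < s)%N by apply: leq_trans kl _; rewrite -ltnS.
  rewrite ks; case: ifP => ls; first exact: hr.
  by apply: leq_trans hi; apply: hr.
rewrite (first_imset (ltnW h)) //; apply/setP=> x; rewrite in_setU1.
apply/orP/imsetP => [[/eqP->|/imsetP[k _ ->]]|[k _ ->]].
- by exists ord_max.
- by exists (widen_ord (leqnSn s) k); rewrite ?fw.
case: (ltnP k s) => ks; last first.
  have -> : k = ord_max by apply: val_inj; apply/eqP; rewrite eqn_leq ks -ltnS ltn_ord.
  by left; rewrite fm.
right; have -> : k = widen_ord (leqnSn s) (Ordinal ks) by apply: val_inj.
by rewrite fw; apply: imset_f.
Qed.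

(** The minor is the leading one for j.+1 pivots with its last row replaced by
    row i, so dividing by that leading minor isolates L i j over the pivot. *)
Lemma echelon_entry (m n t : nat) (r : 'I_t -> 'I_m) (c : 'I_t -> 'I_n)
    (L : 'M[F]_(m, t)) (V : 'M[F]_(n, t)) (i : 'I_m) (j : 'I_t) :
  incr r -> incr c -> echelon r L -> echelon c V -> (r j <= i)%N ->
  minor (L *m V^T) (i |: first j (r @: setT)) (first j.+1 (c @: setT)) =
  (\prod_(k < j) L (r (widen_ord (ltnW (ltn_ord j)) k)) (widen_ord (ltnW (ltn_ord j)) k))
   * L i j * \prod_(k < j.+1) V (c (widen_ord (ltn_ord j) k)) (widen_ord (ltn_ord j) k).
Proof.
move=> hr hc eL eV ij; set h := ltn_ord j.
have ej : Ordinal h = j by apply: val_inj.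
have [f hf [-> fm fw]] := setU1_imset (h := h) hr (i := i) ltac:(by rewrite ej).
rewrite (first_imset h) // minor_imset //; last first.
  by apply: incr_comp => //; apply: widen_incr.
by rewrite det_mul_echelon // (det_echelon_last _ eL fw) // fm ej.
Qed.

End Echelon.

Lemma minor_tr (R : comNzRingType) (m n : nat) (A : 'M[R]_(m, n)) (I : {set 'I_m})
    (J : {set 'I_n}) : #|I| = #|J| -> minor A^T J I = minor A I J.
Proof.
move=> e; rewrite (minor_elt A e erefl) (minor_elt _ erefl e).
by rewrite -trmx_mxsub det_tr.
Qed.

Lemma card_first (p s : nat) (I : {set 'I_p}) : (s <= #|I|)%N -> #|first s I| = s.
Proof.
move=> hs; rewrite /first cardsE (card_uniqP _) ?take_uniq ?enum_uniq //.
by rewrite size_take_min -cardE (minn_idPl hs).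
Qed.

Lemma card_setU1_first (p t : nat) (I : {set 'I_p}) (e : #|I| = t) (j : 'I_t) (i : 'I_p) :
  (elt e j <= i)%N -> #|i |: first j I| = j.+1.
Proof.
move=> hi; have ej : Ordinal (ltn_ord j) = j by apply: val_inj.
have [|f hf [ef _ _]] := setU1_imset (h := ltn_ord j) (r := elt e) (i := i) (elt_incr e).
  by rewrite ej.
by rewrite elt_imset in ef; rewrite ef card_imset_incr.
Qed.

Lemma in_U_tr (F : fieldType) (n t : nat) (c : {set 'I_n}) (hc : #|c| = t)
    (U : 'M[F]_(t, n)) : in_U hc U <-> in_L hc U^T.
Proof.
split=> h j; have [nz z] := h j; split.
- by rewrite mxE.
- by move=> i /z; rewrite mxE.
- by rewrite mxE in nz.
- by move=> i /z; rewrite mxE.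
Qed.

(** The entries of U follow from those of its transpose, a left echelon factor
    of the transposed product; the unit pivots of L drop out. *)
Lemma LU_entries (F : fieldType) (m n t : nat) (r : {set 'I_m}) (c : {set 'I_n})
    (hr : #|r| = t) (hc : #|c| = t) (L : 'M[F]_(m, t)) (U : 'M[F]_(t, n)) :
  in_Lstar hr L -> in_U hc U ->
  L = \matrix_(i < m, j < t)
        (if (i < elt hr j)%N then 0
         else minor (L *m U) (i |: first j r) (first j.+1 c)
              * (minor (L *m U) (first j.+1 r) (first j.+1 c))^-1) /\
  U = \matrix_(i < t, j < n)
        (if (j < elt hc i)%N then 0
         else minor (L *m U) (first i.+1 r) (j |: first i c)
              * (minor (L *m U) (first i r) (first i c))^-1).
Proof.
move=> [eL L1] /in_U_tr eU; pose V := U^T.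
have -> : L *m U = L *m V^T by rewrite trmxK.
have ir := elt_incr hr; have ic := elt_incr hc.
have prodL s (h : (s <= t)%N) :
    \prod_(k < s) L (elt hr (widen_ord h k)) (widen_ord h k) = 1.
  by rewrite big1 // => k _; apply: L1.
have minors s (h : (s <= t)%N) : minor (L *m V^T) (first s r) (first s c) =
    \prod_(k < s) V (elt hc (widen_ord h k)) (widen_ord h k).
  have := minor_first_echelon h ir ic eL eU.
  by rewrite !elt_imset prodL mul1r.
split; apply/matrixP=> i j; rewrite mxE; case: ltnP => hij.
- by have [_ ->] := eL j.
- have := echelon_entry ir ic eL eU hij.
  rewrite !elt_imset prodL mul1r (minors _ (ltn_ord j)) => ->.
  by rewrite mulfK // prod_echelon_neq0.
- by have [_ /(_ j hij)] := eU i; rewrite mxE.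
- have := echelon_entry ic ir eU eL hij.
  have -> : U^T *m L^T = (L *m V^T)^T by rewrite trmx_mul trmxK.
  rewrite !elt_imset minor_tr; last first.
    by rewrite card_first ?hr // (card_setU1_first (e := hc)).
  rewrite prodL mulr1 (minors _ (ltnW (ltn_ord i))) => ->.
  rewrite mulrAC mulfV ?mul1r ?mxE //; exact: prod_echelon_neq0.
Qed.

Theorem theorem2p10 (R : realFieldType) (m n : nat) (A : 'M[R]_(m, n))
    (hA : totally_nonneg A) :
  (exists! rc : {set 'I_m} * {set 'I_n},
      #|rc.1| = #|rc.2| /\ in_M rc.1 rc.2 A) /\
  (forall (t : nat) (r : {set 'I_m}) (c : {set 'I_n})
          (hr : #|r| = t) (hc : #|c| = t),
      in_M r c A ->
      (exists! LU : 'M[R]_(m, t) * 'M[R]_(t, n),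
          [/\ in_Lstar hr LU.1, in_U hc LU.2 & A = LU.1 *m LU.2]) /\
      (forall (L : 'M[R]_(m, t)) (U : 'M[R]_(t, n)),
          in_Lstar hr L -> in_U hc U -> A = L *m U ->
          [/\ totally_nonneg L,
              totally_nonneg U,
              L = \matrix_(i < m, j < t)
                    (if (i < elt hr j)%N then 0
                     else minor A (i |: first j r) (first j.+1 c)
                          * (minor A (first j.+1 r) (first j.+1 c))^-1)
            & U = \matrix_(i < t, j < n)
                    (if (j < elt hc i)%N then 0
                     else minor A (first i.+1 r) (j |: first i c)
                          * (minor A (first i r) (first i c))^-1)])).
Proof.
have /tnn_LU := (totally_nonnegP A).1 hA.
case=> t0 [r0 [c0 [L0 [U0 [[ir ic] [eL L1] eU [tL tU] eA]]]]].
have cr := card_imset_incr ir; have cc := card_imset_incr ic.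
have inM : in_M (r0 @: setT) (c0 @: setT) A.
  by rewrite eA -[U0]trmxK; apply: in_M_LU.
split.
  exists (r0 @: setT, c0 @: setT); split=> /=; first by rewrite cr cc.
  case=> r c /= [e /(in_M_inj _ e inM)]; rewrite cr cc => /(_ erefl).
  by case=> -> ->.
move=> t r c hr hc hM.
have [er ec] : r = r0 @: setT /\ c = c0 @: setT.
  by apply: in_M_inj hM inM; rewrite ?hr ?hc ?cr ?cc.
have et : t0 = t by rewrite -hr er cr.
move: et; subst r c => et; case: t / et hr hc {hM} => hr hc.
have er := elt_imset_incr hr ir; have ec := elt_imset_incr hc ic.
have hL0 : in_Lstar hr L0.
  by split=> j; [have [] := eL j|]; rewrite er //; apply: L1.
have hU0 : in_U hc U0.
  by apply/in_U_tr => j; rewrite ec; apply: eU.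
have uniq L U : in_Lstar hr L -> in_U hc U -> A = L *m U -> L = L0 /\ U = U0.
  move=> hL hU eLU.
  have [e1 e2] := LU_entries hL hU; have [e3 e4] := LU_entries hL0 hU0.
  by rewrite -eLU eA -e3 in e1; rewrite -eLU eA -e4 in e2.
split.
  exists (L0, U0); split=> //= -[L U] /= [hL hU eLU].
  by have [-> ->] := uniq L U hL hU eLU.
move=> L U hL hU eLU; have [e1 e2] := LU_entries hL hU.
have [eL0 eU0] := uniq L U hL hU eLU.
by split; rewrite ?eLU //; apply/totally_nonnegP; rewrite ?eL0 ?eU0.
Qed.
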